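(* Let $\ell \geq 2$, $m \geq 1$, $n \geq 1$ be integers and let $q$ be a prime power. Let $G=(V,E)$ be an $\ell$-partite graph with vertex partition $V = V_1 \sqcup \cdots \sqcup V_\ell$ (no edge joins two vertices of the same part) such that $|V_1| = \cdots = |V_\ell| = m$ and such that every vertex $v \in V_i$ has exactly $n$ neighbours in $V_j$ for every $j \neq i$ (so $G$ is $(\ell-1)n$-regular and $|E| = \ell(\ell-1)mn/2$). Fix a total order on $E$. Let $C \subseteq \mathbb{F}_q^{(\ell-1)n}$ be a linear $[(\ell-1)n, k, d]$-code, and let $C_1 = C_2 = \cdots = C_\ell = C$. Let $\mathcal{C}$ be the generalized graph code on $G$ with component codes $C_1,\dots,C_\ell$, i.e. $$\mathcal{C} = \{ c \in \mathbb{F}_q^{E} \cong \mathbb{F}_q^{\ell(\ell-1)mn/2} \mid c(v) \in C_i \text{ for every } i \in \{1,\dots,\ell\} \text{ and every } v \in V_i \},$$ and let $D$ denote the minimum distance of $\mathcal{C}$. Let $\lambda_2$ be the second largest eigenvalue of the adjacency matrix of $G$. Then $$D \geq \frac{d\,m\,(d-\lambda_2)}{(\ell-1)n - \lambda_2}.$$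
   Context: A codeword $c \in \mathbb{F}_q^E$ is an assignment of a symbol $c_e \in \mathbb{F}_q$ to each edge $e$, listed according to the fixed total order on $E$. For a vertex $v$, $c(v) \in \mathbb{F}_q^{(\ell-1)n}$ denotes the word obtained by reading the symbols $c_e$ on the $(\ell-1)n$ edges $e$ incident to $v$, in the order induced by the fixed total order on $E$. A linear $[N,k,d]$-code over $\mathbb{F}_q$ is a $k$-dimensional subspace of $\mathbb{F}_q^N$ whose minimum Hamming distance (equivalently, minimum Hamming weight of a nonzero codeword) is $d$. The minimum distance of $\mathcal{C}$ is the minimum Hamming weight of a nonzero codeword of $\mathcal{C}$ (Hamming weight = number of edges carrying a nonzero symbol). *)

(* Defs.v *)
From HB Require Import structures.
From mathcomp Require Import all_boot all_order all_algebra.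
From mathcomp Require Import reals.

Set Implicit Arguments.
Unset Strict Implicit.
Unset Printing Implicit Defensive.

Import Order.TTheory GRing.Theory Num.Theory.
Local Open Scope ring_scope.

(* F^I for a finite index type I. The regular module F^o is what gives
   {ffun I -> F^o} its canonical F-vector space structure. *)
Notation word F I := {ffun I -> F^o}.

Definition hamming_weight (F : finFieldType) (I : finType) (c : word F I) : nat :=
  #|[set i | c i != 0]|.

(* A relation rather than a function: the minimum distance of a code without
   nonzero codewords is undefined. *)
Definition is_min_distance (F : finFieldType) (I : finType)
    (C : {pred word F I}) (d : nat) : Prop :=
  (exists c, [/\ c \in C, c != 0 & hamming_weight c = d]) /\
  (forall c, c \in C -> c != 0 -> (d <= hamming_weight c)%N).

Definition linear_code (F : finFieldType) (N : nat)
    (C : {vspace word F 'I_N}) (k d : nat) : Prop :=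
  \dim C = k /\ is_min_distance (mem C) d.

Definition total_order (T : Type) (le : rel T) : Prop :=
  [/\ reflexive le, antisymmetric le, transitive le & total le].

Definition simple_graph (V : finType) (adj : rel V) : Prop :=
  symmetric adj /\ irreflexive adj.

Definition edge_set (V : finType) (adj : rel V) : {set {set V}} :=
  [set [set p.1; p.2] | p : V * V & adj p.1 p.2].

Definition edge (V : finType) (adj : rel V) : finType :=
  {A : {set V} | A \in edge_set adj}.

Definition incident_edges (V : finType) (adj : rel V) (le : rel (edge adj))
    (v : V) : seq (edge adj) :=
  sort le (enum [pred e : edge adj | v \in val e]).

(* The word c(v). The length N is meant to be the degree of v; the default
   value of nth is then never used. *)
Definition local_word (F : finFieldType) (V : finType) (adj : rel V)
    (le : rel (edge adj)) (N : nat) (c : word F (edge adj)) (v : V) :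
    word F 'I_N :=
  [ffun i : 'I_N => nth 0 [seq c e | e <- incident_edges le v] i].

Definition graph_code (F : finFieldType) (V : finType) (adj : rel V)
    (le : rel (edge adj)) (l N : nat) (part : V -> 'I_l)
    (C : 'I_l -> {vspace word F 'I_N}) : {pred word F (edge adj)} :=
  [pred c | [forall v, local_word le N c v \in C (part v)]].

Definition adjacency_matrix (R : realType) (V : finType) (adj : rel V) :
    'M[R]_#|V| :=
  \matrix_(i, j) (adj (enum_val i) (enum_val j))%:R.

(* s lists the eigenvalues of A with multiplicity, in nonincreasing order. *)
Definition ordered_spectrum (R : realType) (n : nat) (A : 'M[R]_n)
    (s : seq R) : Prop :=
  sorted >=%R s /\ char_poly A = \prod_(x <- s) ('X - x%:P).

Definition second_largest_eigenvalue (R : realType) (n : nat) (A : 'M[R]_n)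
    (lambda : R) : Prop :=
  exists s : seq R,
    [/\ ordered_spectrum A s, (1 < size s)%N & lambda = s`_1].

(* Main.v *)
(* Let c be a nonzero codeword, S the set of vertices meeting its support, and
   r = (l-1)n the degree of G. Every v in S sees a nonzero word of C, so at
   least d edges of the support leave v, all of them inside S: G[S] has minimum
   degree at least d, and 2 wt(c) >= d |S|. The all-ones vector is an
   eigenvector for r, and on its orthogonal complement the quadratic form of
   the adjacency matrix is at most lambda2 times the squared norm (spectral
   theorem over R[i]). Applied to the component of the indicator of S orthogonal
   to the all-ones vector, this gives |V| (d - lambda2) <= (r - lambda2) |S|.
   Since |V| = l m >= 2 m, the bound follows when d >= lambda2; otherwise its
   left-hand side is nonpositive, and for lambda2 = r it is 0 because x / 0 = 0. *)
Require Import Defs.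
From HB Require Import structures.
From mathcomp Require Import all_boot all_order all_algebra.
From mathcomp Require Import reals.
From mathcomp Require Import complex ring.
From mathcomp Require Import spectral sesquilinear.

Set Implicit Arguments.
Unset Strict Implicit.
Unset Printing Implicit Defensive.

Import Order.TTheory GRing.Theory Num.Theory.
Local Open Scope ring_scope.

(** * Spectral estimates for Hermitian and real symmetric matrices *)

Lemma char_poly_conj (F : fieldType) (n : nat) (P B : 'M[F]_n) :
  P \in unitmx -> char_poly (invmx P *m B *m P) = char_poly B.
Proof.
move=> Pu; rewrite /char_poly /char_poly_mx !map_mxM.
set Q := map_mx _ (invmx P); set P' := map_mx _ P.
have QP : Q *m P' = 1%:M by rewrite -map_mxM mulVmx // map_mx1.
have -> : 'X%:M - Q *m map_mx polyC B *m P' =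
    Q *m ('X%:M - map_mx polyC B) *m P'.
  by rewrite mulmxBr mulmxBl mul_mx_scalar -scalemxAl QP scalemx1.
by rewrite !det_mulmx mulrAC -det_mulmx QP det1 mul1r.
Qed.

Section Spectral.
Local Open Scope sesquilinear_scope.

(** At most one entry of [s] fails to be bounded by its second entry, so [r] is a simple eigenvalue
    and [u] spans its eigenline. In an orthonormal eigenbasis, a vector orthogonal to [u] has no
    coordinate there, and all its other coordinates carry eigenvalues that obey the bound. *)
Lemma quad_form_orth_top (K : numClosedFieldType) (n : nat) (A : 'M[K]_n)
    (s : seq K) (r : K) (u x : 'rV[K]_n) :
  A \is hermsymmx -> sorted >=%R s ->
  char_poly A = \prod_(z <- s) ('X - z%:P) ->
  ~~ (r <= s`_1) -> u != 0 -> u *m A = r *: u -> x *m u ^t* = 0 ->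
  (x *m A *m x ^t*) 0 0 <= s`_1 * (x *m x ^t*) 0 0.
Proof.
move=> Aherm s_sorted Achar rs u0 uA xu.
have := hermitian_normalmx Aherm; move/orthomx_spectralP.
have := spectral_unitarymx A; have := spectral_unit A.
set P := spectralmx A; set d := spectral_diag A => Pu Pun AE.
have PV : invmx P = P^t* by exact: invmx_unitary.
have PtP : P^t* *m P = 1%:M by rewrite -PV mulVmx.
(* Both lists are the roots, with multiplicity, of the same characteristic polynomial. *)
have perm_s : perm_eq s [seq d 0 i | i <- enum 'I_n].
  apply: prod_XsubC_eq; rewrite -Achar AE char_poly_conj //.
  rewrite char_poly_trig ?diag_mx_is_trig // big_map big_enum /=.
  by apply: eq_bigr => i _; rewrite mxE eqxx mulr1n.
(* Stated with [~~ (_ <= _)] because the order of K is only partial. *)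
have cnt : (count (fun z => ~~ (z <= s`_1)%R) s <= 1)%N.
  case: (s) s_sorted => [|a [|b t]] //=; first by rewrite addn0 leq_b1.
  move=> /andP[_]; rewrite path_sortedE; last first.
    by move=> ? ? ? /[swap]; exact: le_trans.
  move=> /andP[/allP bt _].
  rewrite lexx add0n [X in (_ + X)%N](_ : _ = 0%N) ?addn0 ?leq_b1 //.
  apply/eqP; rewrite -leqn0 leqNgt -has_count; apply/hasPn => z /bt /=.
  by rewrite negbK.
(* Coordinates of [u] and [x] in the eigenbasis formed by the rows of [P]. *)
have [v vE] : {v | v = u *m P^t*} by exists (u *m P^t*).
have [y yE] : {y | y = x *m P^t*} by exists (x *m P^t*).
have vd i : v 0 i * d 0 i = r * v 0 i.
  have : v *m diag_mx d = r *: v.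
    rewrite vE scalemxAl -uA [in RHS]AE PV !mulmxA -(mulmxA _ P).
    by move/unitarymxP: Pun => ->; rewrite mulmx1.
  by move/rowP/(_ i); rewrite mul_mx_diag !mxE.
have [i0 vi0] : exists i, v 0 i != 0.
  apply/existsP; apply: contraNT u0 => /existsPn v0.
  have : v = 0.
    by apply/rowP => i; rewrite [RHS]mxE; have := v0 i; rewrite negbK => /eqP.
  by move/(congr1 (mulmx^~ P)); rewrite vE -mulmxA PtP mulmx1 mul0mx => ->.
have top i : v 0 i != 0 -> d 0 i = r.
  by move=> vi; apply: (mulfI vi); rewrite vd mulrC.
(* A second index with too large an eigenvalue, besides [i0], would contradict [cnt]. *)
have low i : i != i0 -> d 0 i <= s`_1.
  move=> ii0; apply: contraTT cnt => di; rewrite -ltnNge.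
  rewrite (permP perm_s) count_map -size_filter.
  have -> : 2%N = size [:: i; i0] by [].
  apply: uniq_leq_size; first by rewrite /= inE ii0.
  by move=> j; rewrite !inE mem_filter mem_enum andbT => /orP[]/eqP-> //=;
    rewrite top.
(* By [top] and [low], [v] vanishes off [i0], so orthogonality of [y] and [v] reduces to the term at
   [i0]. *)
have yi0 : y 0 i0 = 0.
  have : y *m v^t* = 0.
    rewrite yE vE trmx_mul map_mxM map_trmx trmxK -map_mx_comp.
    by rewrite (map_mx_id (@conjCK _)) mulmxA -(mulmxA x) PtP mulmx1.
  move/matrixP/(_ 0 0); rewrite !mxE (bigD1 i0) //= big1 ?addr0 => [|i ii0].
    by move/eqP; rewrite !mxE mulf_eq0 conjC_eq0 (negPf vi0) orbF => /eqP.
  rewrite !mxE; have [->|/top di] := eqVneq (v 0 i) 0;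
    first by rewrite conjC0 mulr0.
  by move: (low i ii0); rewrite di (negPf rs).
have -> : x *m x^t* = y *m y^t*.
  rewrite yE trmx_mul map_mxM map_trmx trmxK -map_mx_comp.
  by rewrite (map_mx_id (@conjCK _)) mulmxA -(mulmxA x) PtP mulmx1.
have -> : x *m A *m x^t* = y *m diag_mx d *m y^t*.
  rewrite yE trmx_mul map_mxM map_trmx trmxK -map_mx_comp.
  by rewrite (map_mx_id (@conjCK _)) [in LHS]AE PV !mulmxA.
rewrite mul_mx_diag [X in X <= _]mxE [X in _ * X]mxE mulr_sumr ler_sum // => i _.
rewrite !mxE; have [->|ii0] := eqVneq i i0; first by rewrite yi0 !mul0r mulr0.
by rewrite mulrAC mulrC ler_wpM2r ?mul_conjC_ge0 // low.
Qed.

End Spectral.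

(** Transfer along the embedding of [R] into its complex numbers: conjugation fixes the entries, so
    the conjugate transpose is the plain one. *)
Lemma quad_form_orth_top_real (R : realType) (n : nat) (A : 'M[R]_n)
    (lambda r : R) (u x : 'rV[R]_n) :
  A^T = A -> second_largest_eigenvalue A lambda -> lambda < r ->
  u != 0 -> u *m A = r *: u -> x *m u^T = 0 ->
  (x *m A *m x^T) 0 0 <= lambda * (x *m x^T) 0 0.
Proof.
move=> Asym [s [[s_sorted Achar] s1 ->]] s_r u0 uA xu.
pose f := real_complex R.
have freal m p (B : 'M[R]_(m, p)) : map_mx f B \is a mxOver Num.real.
  by apply/mxOverP => i j; rewrite mxE complex_real eqxx.
have ftc m p (B : 'M[R]_(m, p)) :
    map_mx Num.conj ((map_mx f B)^T) = map_mx f B^T.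
  by apply/matrixP => i j; rewrite !mxE; exact: conjc_real.
have sf : (map f s)`_1 = f s`_1 by rewrite (nth_map 0).
have := @quad_form_orth_top _ _ (map_mx f A) (map f s) (f r) (map_mx f u)
  (map_mx f x).
have fE (B : 'M[R]_1) : map_mx f B 0 0 = f (B 0 0) by rewrite mxE.
rewrite !ftc sf -!map_mxM !fE -rmorphM /= !lecR; apply.
- apply: realsym_hermsym => //; apply/is_hermitianmxP.
  by rewrite expr0 scale1r map_mx_id // map_trmx Asym.
- by rewrite sorted_map; apply: sub_sorted s_sorted => a b; rewrite /= lecR.
- rewrite -map_char_poly Achar rmorph_prod big_map /=.
  by apply: eq_bigr => z _; rewrite rmorphB /= map_polyX map_polyC.
- by rewrite -ltNge.
- by rewrite map_mx_eq0.
- by rewrite uA map_mxZ.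
- by rewrite xu map_mx0.
Qed.

Lemma eigenvalue_le_row_sum (R : realType) (n : nat) (A : 'M[R]_n) (r a : R) :
  A^T = A -> (forall i j, 0 <= A i j) -> (forall i, \sum_j A i j = r) ->
  eigenvalue A a -> a <= r.
Proof.
move=> Asym A0 Ar /eigenvalueP[v vA v0].
have AS i j : A j i = A i j by rewrite -[in LHS]Asym mxE.
have [i vi] : exists i, v 0 i != 0.
  apply/existsP; apply: contraNT v0 => /existsPn v0.
  by apply/eqP/rowP => i; rewrite mxE; have := v0 i; rewrite negbK => /eqP.
have vv : 0 < \sum_i v 0 i ^+ 2.
  rewrite (bigD1 i) //= ltr_wpDr ?sumr_ge0 // => [? _|]; rewrite ?sqr_ge0 //.
  by rewrite lt_def sqr_ge0 sqrf_eq0 vi.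
have vav : \sum_i \sum_j A i j * (v 0 i * v 0 j) = a * \sum_i v 0 i ^+ 2.
  rewrite exchange_big mulr_sumr; apply: eq_bigr => j _ /=.
  move/rowP/(_ j): vA; rewrite !mxE expr2 mulrA => <-; rewrite mulr_suml.
  by apply: eq_bigr => k _; rewrite mulrCA mulrA.
have vrv : \sum_i \sum_j A i j * v 0 i ^+ 2 = r * \sum_i v 0 i ^+ 2.
  rewrite mulr_sumr; apply: eq_bigr => j _ /=.
  by rewrite -mulr_suml Ar.
have vrv' : \sum_i \sum_j A i j * v 0 j ^+ 2 = r * \sum_i v 0 i ^+ 2.
  rewrite exchange_big mulr_sumr; apply: eq_bigr => j _ /=.
  by rewrite -mulr_suml -(Ar j); congr (_ * _); apply: eq_bigr.
(* Twice the difference is [\sum_(i, j) A i j * (v i - v j) ^+ 2]. *)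
rewrite -(ler_pM2r vv) -subr_ge0 -(pmulrn_lge0 _ (ltn0Sn 1)) mulr2n.
rewrite -[in X in 0 <= X + _]vrv -vrv' -vav -!sumrB -big_split /=.
apply: sumr_ge0 => k _; rewrite -!sumrB -big_split /=; apply: sumr_ge0 => j _.
suff -> : A k j * v 0 k ^+ 2 - A k j * (v 0 k * v 0 j)
    + (A k j * v 0 j ^+ 2 - A k j * (v 0 k * v 0 j)) =
    A k j * (v 0 k - v 0 j) ^+ 2 by rewrite mulr_ge0 ?sqr_ge0.
by ring.
Qed.

(** The all-ones vector is an eigenvector for [r], so the previous bound applies to the component of
    [w] orthogonal to it; the squared coordinate sum accounts for the removed component. *)
Lemma quad_form_regular (R : realType) (n : nat) (A : 'M[R]_n)
    (lambda r : R) (w : 'rV[R]_n) :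
  A^T = A -> (forall i, \sum_j A i j = r) ->
  second_largest_eigenvalue A lambda -> lambda < r ->
  n%:R * (w *m A *m w^T) 0 0 <=
    n%:R * lambda * (w *m w^T) 0 0 + (r - lambda) * (\sum_i w 0 i) ^+ 2.
Proof.
move=> Asym Ar lam_A lam_r.
(* A factor [n] is cancelled at the end, so the empty matrix is treated apart. *)
have [n0|n_gt0] := posnP n.
  have -> : n%:R = 0 :> R by rewrite [in LHS]n0.
  by rewrite !mul0r add0r mulr_ge0 ?sqr_ge0 // subr_ge0 ltW.
pose e : 'rV[R]_n := const_mx 1; pose t := \sum_i w 0 i.
have eA : e *m A = r *: e.
  apply/rowP => j; rewrite !mxE mulr1 -(Ar j).
  by apply: eq_bigr => i _; rewrite mxE mul1r -[in LHS]Asym mxE.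
have we : w *m e^T = t%:M.
  apply/matrixP => i j; rewrite !ord1 !mxE mulr1n.
  by apply: eq_bigr => k _; rewrite !mxE mulr1.
have ew : e *m w^T = t%:M by rewrite -[LHS]trmxK trmx_mul trmxK we tr_scalar_mx.
have ee : e *m e^T = n%:R%:M.
  apply/matrixP => i j; rewrite !ord1 !mxE mulr1n.
  under eq_bigr do rewrite !mxE mulr1.
  by rewrite sumr_const card_ord.
have Ae : A *m e^T = r *: e^T.
  by rewrite -[LHS]trmxK trmx_mul trmxK Asym eA linearZ.
have e0 : e != 0.
  by apply/eqP => /rowP/(_ (Ordinal n_gt0)); rewrite !mxE => /eqP; rewrite oner_eq0.
(* The vector is [n] times the component of [w] orthogonal to [e], which avoids a division. *)
have := @quad_form_orth_top_real R n A lambda r e (n%:R *: w - t *: e)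
  Asym lam_A lam_r e0 eA.
rewrite mulmxBl -!scalemxAl we ee !scale_scalar_mx mulrC subrr => /(_ erefl).
have -> : (n%:R *: w - t *: e)^T = n%:R *: w^T - t *: e^T.
  by apply/matrixP => i j; rewrite !mxE.
rewrite !(mulmxBl, mulmxBr) -!scalemxAl -!scalemxAr eA -!(mulmxA w A) Ae.
rewrite -!scalemxAl -!scalemxAr we ew ee -/t.
move: (w *m (A *m w^T)) (w *m w^T) => a b; rewrite !mxE !mulr1n => le_ab.
rewrite -(ler_pM2l (_ : 0 < n%:R)) ?ltr0n // -subr_ge0.
by move: le_ab; rewrite -subr_ge0; congr (0 <= _); ring.
Qed.

(** * Adjacency matrices of regular graphs *)

Lemma sum_enum_val (R : nmodType) (V : finType) (F : V -> R) :
  \sum_(i < #|V|) F (enum_val i) = \sum_v F v.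
Proof. by rewrite [RHS](reindex _ (onW_bij _ (@enum_val_bij V))). Qed.

Section RegularGraph.
Variables (R : realType) (V : finType) (adj : rel V).

Lemma adjacency_row_sum (v : 'I_#|V|) :
  \sum_j adjacency_matrix R adj v j = #|[set w | adj (enum_val v) w]|%:R.
Proof.
under eq_bigr do rewrite mxE.
rewrite (sum_enum_val (fun w => (adj (enum_val v) w)%:R)) -natr_sum.
by rewrite -sum1dep_card [in RHS]big_mkcond.
Qed.

(** For the indicator of [S], the quadratic form counts ordered adjacent pairs inside [S], at least
    [a * #|S|] of them, while the squared norm and the coordinate sum are both [#|S|]. One factor
    [#|S|] then cancels. *)
Lemma induced_degree_le (r a : nat) (lambda : R) (S : {set V}) :
  symmetric adj -> (forall v, #|[set w | adj v w]| = r) ->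
  second_largest_eigenvalue (adjacency_matrix R adj) lambda ->
  lambda < r%:R -> (0 < #|S|)%N ->
  (forall v, v \in S -> (a <= #|[set w | adj v w & w \in S]|)%N) ->
  #|V|%:R * (a%:R - lambda) <= (r%:R - lambda) * #|S|%:R.
Proof.
move=> adj_sym deg lam_A lam_r S0 a_le.
pose w : 'rV[R]_#|V| := \row_j (enum_val j \in S)%:R.
have Asym : (adjacency_matrix R adj)^T = adjacency_matrix R adj.
  by apply/matrixP => i j; rewrite !mxE adj_sym.
have Ar i : \sum_j adjacency_matrix R adj i j = r%:R.
  by rewrite adjacency_row_sum deg.
have := quad_form_regular w Asym Ar lam_A lam_r.
have -> : \sum_i w 0 i = #|S|%:R.
  under eq_bigr do rewrite mxE.
  by rewrite (sum_enum_val (fun v => (v \in S)%:R)) -natr_sum -sum1_card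
    [in RHS]big_mkcond.
have -> : (w *m w^T) 0 0 = #|S|%:R.
  rewrite mxE; under eq_bigr do rewrite !mxE -natrM mulnb andbb.
  by rewrite (sum_enum_val (fun v => (v \in S)%:R)) -natr_sum -sum1_card
    [in RHS]big_mkcond.
have -> : (w *m adjacency_matrix R adj *m w^T) 0 0 =
    (\sum_(v in S) #|[set w | adj v w & w \in S]|)%:R.
  rewrite mxE; under [LHS]eq_bigr do rewrite !mxE mulr_suml.
  rewrite exchange_big /= natr_sum [RHS]big_mkcond -[RHS]sum_enum_val.
  apply: eq_bigr => i _; under eq_bigr do rewrite !mxE -mulrA.
  rewrite -mulr_sumr.
  rewrite (sum_enum_val (fun v => (adj (enum_val i) v)%:R * (v \in S)%:R)).
  case: (enum_val i \in S); rewrite ?mul0r // mul1r.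
  under eq_bigr do rewrite -natrM mulnb.
  by rewrite -natr_sum -sum1dep_card [in RHS]big_mkcond; congr (_%:R).
have : (a * #|S| <= \sum_(v in S) #|[set w | adj v w & w \in S]|)%N.
  by rewrite mulnC -sum_nat_const leq_sum.
rewrite -(ler_nat R) natrM => /(ler_wpM2l (ler0n _ #|V|)) /le_trans /[apply] le_S.
rewrite -(ler_pM2r (_ : 0 < #|S|%:R :> R)) ?ltr0n // -subr_ge0.
by move: le_S; rewrite -subr_ge0; congr (0 <= _); ring.
Qed.

(** Leaves only the degenerate case of equality besides the strict inequality that
    [induced_degree_le] assumes. *)
Lemma second_largest_eigenvalue_le (r : nat) (lambda : R) :
  symmetric adj -> (forall v, #|[set w | adj v w]| = r) ->
  second_largest_eigenvalue (adjacency_matrix R adj) lambda ->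
  lambda <= r%:R.
Proof.
move=> adj_sym deg [s [[_ sE] s1 ->]].
apply: (@eigenvalue_le_row_sum _ _ (adjacency_matrix R adj)).
- by apply/matrixP => i j; rewrite !mxE adj_sym.
- by move=> i j; rewrite mxE ler0n.
- by move=> i; rewrite adjacency_row_sum deg.
- by rewrite eigenvalue_root_char sE root_prod_XsubC mem_nth.
Qed.

End RegularGraph.

(** * Edges and their endpoints *)

Section Edges.
Variables (V : finType) (adj : rel V).
Implicit Types (P : pred (edge adj)) (v w : V).

Lemma edge_endpoints (e : edge adj) :
  exists v w, adj v w /\ val e = [set v; w].
Proof. by case/imsetP: (valP e) => -[v w]; rewrite inE => vw ->; exists v, w. Qed.

(** An edge through [v] is determined by its other endpoint, which itself lies on an edge satisfying
    [P]. *)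
Lemma edges_at_le_neighbors P v : symmetric adj ->
  (#|[set e | P e & v \in val e]| <=
   #|[set w | adj v w & [exists e, P e && (w \in val e)]]|)%N.
Proof.
move=> adj_sym; rewrite -(card_imset _ val_inj).
apply: leq_trans (leq_imset_card (fun w => [set v; w]) _).
apply/subset_leq_card/subsetP => _ /imsetP[e eP ->].
move: eP; rewrite inE => /andP[Pe].
have [x [y [xy eE]]] := edge_endpoints e.
rewrite eE !inE => /orP[]/eqP ?; subst v; apply/imsetP.
  exists y => //; rewrite inE xy; apply/existsP; exists e.
  by rewrite Pe eE !inE eqxx orbT.
exists x; last by rewrite setUC.
rewrite inE adj_sym xy; apply/existsP; exists e.
by rewrite Pe eE !inE eqxx.
Qed.

(** Double counting of incidences; irreflexivity makes the two endpoints of an edge distinct. *)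
Lemma handshake P : irreflexive adj ->
  (\sum_v #|[set e | P e & v \in val e]| = 2 * #|[set e | P e]|)%N.
Proof.
move=> adj_irr.
under eq_bigr => v _ do rewrite -sum1dep_card big_mkcondr /=.
rewrite exchange_big /= mulnC -sum_nat_const big_set /=; apply: eq_bigr => e _.
rewrite -big_mkcond sum1_card.
have [x [y [xy ->]]] := edge_endpoints e; rewrite cards2.
by case: eqP xy => // ->; rewrite adj_irr.
Qed.

End Edges.

(** * Words read at a vertex *)

(** Positions past the end of [t] read the default 0 and count nothing; truncation at [N] can only
    lose entries. *)
Lemma sum_nth_neq0_le (F : nmodType) (t : seq F) (N : nat) :
  (\sum_(i < N) (nth 0 t i != 0)%R <= count (predC1 0%R) t)%N.
Proof.
elim: t N => [|x t IH] [|N]; rewrite ?big_ord0 //.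
  by rewrite big1 // => i _; rewrite nth_nil eqxx.
by rewrite big_ord_recl /= leq_add2l IH.
Qed.

Section LocalWord.
Variables (F : finFieldType) (V : finType) (adj : rel V) (le : rel (edge adj)).
Variables (N : nat) (c : word F (edge adj)) (v : V).

Lemma local_word_weight :
  (hamming_weight (local_word le N c v) <=
   #|[set e | (c e != 0)%R & v \in val e]|)%N.
Proof.
rewrite /hamming_weight -sum1dep_card big_mkcond /=.
under eq_bigr do rewrite ffunE.
apply: leq_trans (sum_nth_neq0_le _ N) _.
rewrite count_map /incident_edges (permP (permEl (perm_sort _ _))).
rewrite -size_filter cardE; apply: uniq_leq_size.
  by rewrite filter_uniq ?enum_uniq.
by move=> e; rewrite mem_filter !mem_enum !inE.
Qed.

(** The degree bound puts the position of [e] in the sorted list below [N], so its symbol is not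
    truncated away. *)
Lemma local_word_neq0 (e : edge adj) :
  (#|[set e : edge adj | v \in val e]| <= N)%N ->
  c e != 0 -> v \in val e -> local_word le N c v != 0.
Proof.
move=> degN ce ve; set s := incident_edges le v.
have es : e \in s by rewrite mem_sort mem_enum.
have sN : (size s <= N)%N.
  by rewrite size_sort -cardE; apply: leq_trans degN; rewrite cardsE.
have iN : (index e s < N)%N by apply: leq_trans sN; rewrite index_mem.
apply: contraNneq ce => /ffunP/(_ (Ordinal iN)); rewrite !ffunE /=.
by rewrite (nth_map e) ?index_mem // nth_index // => ->.
Qed.

End LocalWord.

(** * Vertex and degree counts in multipartite graphs *)

Section MultipartiteCount.
Variables (l m n : nat) (V : finType) (adj : rel V) (part : V -> 'I_l).

Lemma card_parts :
  (forall i : 'I_l, #|[set v | part v == i]| = m) -> #|V| = (l * m)%N.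
Proof.
move=> card_part; rewrite -sum1_card (partition_big part predT) //=.
under eq_bigr do rewrite sum1dep_card card_part.
by rewrite sum_nat_const card_ord.
Qed.

Lemma multipartite_degree (v : V) :
  (forall u w : V, adj u w -> part u != part w) ->
  (forall j, j != part v -> #|[set w | adj v w && (part w == j)]| = n) ->
  #|[set w | adj v w]| = ((l - 1) * n)%N.
Proof.
move=> hpart nbr; rewrite -sum1dep_card.
rewrite (partition_big part (predC1 (part v))) /= => [|w /hpart]; last first.
  by rewrite eq_sym.
under eq_bigr => j jv do rewrite sum1dep_card nbr //.
by rewrite sum_nat_const cardC1 card_ord subn1.
Qed.

End MultipartiteCount.

Theorem theorem1p1 (R : realType) (l m n q : nat)
  (hl : (2 <= l)%N) (hm : (1 <= m)%N) (hn : (1 <= n)%N)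
  (F : finFieldType) (hq : #|F| = q)
  (V : finType) (adj : rel V) (hadj : simple_graph adj)
  (part : V -> 'I_l)
  (hpart : forall u v : V, adj u v -> part u != part v)
  (hm_part : forall i : 'I_l, #|[set v | part v == i]| = m)
  (hn_nbr : forall (v : V) (j : 'I_l), j != part v ->
    #|[set w | adj v w && (part w == j)]| = n)
  (le_E : rel (edge adj)) (hle_E : total_order le_E)
  (C : {vspace word F 'I_((l - 1) * n)}) (k d : nat)
  (hC : linear_code C k d)
  (D : nat)
  (hD : is_min_distance (graph_code le_E part (fun _ : 'I_l => C)) D)
  (lambda2 : R)
  (hlambda2 : second_largest_eigenvalue (adjacency_matrix R adj) lambda2) :
  d%:R * m%:R * (d%:R - lambda2) / (((l - 1) * n)%:R - lambda2) <= D%:R.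
Proof.
case: hadj => adj_sym adj_irr; case: hC => _ [_ d_min].
case: hD => [[c [c_code c0 <-]] _]; set r := ((l - 1) * n)%N.
have deg v : #|[set w | adj v w]| = r by apply: multipartite_degree (hn_nbr v).
have := second_largest_eigenvalue_le adj_sym deg hlambda2.
rewrite le_eqVlt => /predU1P[->|lam_r]; first by rewrite subrr invr0 mulr0 ler0n.
rewrite ler_pdivrMr ?subr_gt0 //.
have [d_lam|lam_d] := ltP (d%:R : R) lambda2.
  apply: (@le_trans _ _ 0); last by rewrite mulr_ge0 ?ler0n // subr_ge0 ltW.
  by rewrite mulr_ge0_le0 -?natrM ?ler0n // subr_le0 ltW.
pose S := [set v | [exists e, (c e != 0) && (v \in val e)]].
have deg_S v : v \in S -> (d <= #|[set e | (c e != 0)%R & v \in val e]|)%N.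
  rewrite inE => /existsP[e /andP[ce ve]].
  apply: leq_trans (local_word_weight le_E r c v); apply: d_min.
    by move/forallP/(_ v): c_code.
  apply: local_word_neq0 ce ve; rewrite -/r -(deg v).
  (* With [predT], all edges at [v] are counted, and their number is at most the degree. *)
  have := edges_at_le_neighbors predT v adj_sym; rewrite /= => /leq_trans.
  by apply; apply/subset_leq_card/subsetP => w; rewrite !inE => /andP[].
have S_gt0 : (0 < #|S|)%N.
  have [e ce] : exists e, c e != 0.
    apply/existsP; apply: contraNT c0 => /existsPn c0; apply/eqP/ffunP => e.
    by rewrite [RHS]ffunE; have := c0 e; rewrite negbK => /eqP.
  have [x [y [_ eE]]] := edge_endpoints e.
  apply/card_gt0P; exists x; rewrite inE; apply/existsP; exists e.
  by rewrite ce eE !inE eqxx.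
have dS : (d * #|S| <= 2 * hamming_weight c)%N.
  rewrite /hamming_weight -handshake // mulnC -sum_nat_const.
  by rewrite big_mkcond leq_sum // => v _; case: ifP => // /deg_S.
have := @induced_degree_le R V adj r d lambda2 S adj_sym deg hlambda2 lam_r S_gt0.
rewrite (card_parts hm_part) => mixing.
have {}mixing : (l * m)%:R * (d%:R - lambda2) <= (r%:R - lambda2) * #|S|%:R.
  apply: mixing => v /deg_S/leq_trans; apply.
  apply: leq_trans (edges_at_le_neighbors _ v adj_sym) _.
  by apply/subset_leq_card/subsetP => w; rewrite !inE.
(* The goal is doubled because [dS] bounds twice the weight. *)
rewrite -(ler_pM2l (ltr0n R 2)) [leRHS]mulrA -[in leRHS]natrM.
apply: (@le_trans _ _ ((d * #|S|)%:R * (r%:R - lambda2))); last first.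
  by rewrite ler_wpM2r ?ler_nat // subr_ge0 ltW.
have -> : (d * #|S|)%:R * (r%:R - lambda2) =
    d%:R * ((r%:R - lambda2) * #|S|%:R) by rewrite natrM; ring.
apply: le_trans (ler_wpM2l (ler0n R d) mixing).
(* Once the nonnegative factor [d%:R - lambda2] is removed, [2 * d * m <= d * l * m] remains, which
   is where [hl] enters. *)
rewrite !mulrA -!natrM ler_wpM2r ?subr_ge0 // ler_nat.
by rewrite mulnA [(d * l)%N]mulnC !leq_mul2r hl !orbT.
Qed.
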